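(* Let $n\geq 2$ and let $g$ be chosen from the Haar measure of $SO(2n+1,\mathbb{R})$. Let $W(g)$ be the trace of $g$. Then for all real $x_0$, $$\left| \mathbb{P}(W \leq x_0) - \frac{1}{\sqrt{2 \pi}} \int_{-\infty}^{x_0} e^{-\frac{x^2}{2}}\, dx \right| \leq \frac{\sqrt{2}}{n}.$$
   Context: $SO(2n+1,\mathbb{R})$ is the group of $(2n+1)\times(2n+1)$ real orthogonal matrices of determinant $1$. Haar measure is normalized to be a probability measure. *)

(* Defs.v *)
From HB Require Import structures.
From mathcomp Require Import all_boot all_order all_algebra.
From mathcomp Require Import all_classical all_reals all_analysis.

Set Implicit Arguments.
Unset Strict Implicit.
Unset Printing Implicit Defensive.

Import Order.TTheory GRing.Theory Num.Theory.
Import numFieldNormedType.Exports.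

Local Open Scope classical_set_scope.
Local Open Scope ring_scope.

Definition SO_set (R : realType) (m : nat) : set 'M[R]_m :=
  [set A | A *m A^T = 1%:M /\ \det A = 1].

Definition SO (R : realType) (m : nat) : Type := set_type (@SO_set R m).

Definition SO_val (R : realType) (m : nat) (g : SO R m) : 'M[R]_m := \val g.
Coercion SO_val : SO >-> matrix.

(* the topology induced by that of 'M[R]_m *)
HB.instance Definition _ (R : realType) (m : nat) :=
  Topological.copy (SO R m) (set_type (@SO_set R m)).

Section SO_group.
Variables (R : realType) (m : nat).
Implicit Types g h : SO R m.

Lemma SO_val_inj : injective (@SO_val R m).
Proof. exact: val_inj. Qed.

Lemma SO_set1 : @SO_set R m 1%:M.
Proof. by split; [rewrite trmx1 mulmx1 | rewrite det1]. Qed.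

Lemma SO_setM g h : SO_set (g *m h).
Proof.
have [/= gg dg] := set_valP g; have [hh dh] := set_valP h; split.
  by rewrite trmx_mul mulmxA -(mulmxA (SO_val g)) hh mulmx1.
by rewrite det_mulmx dg dh mulr1.
Qed.

Lemma SO_setV g : SO_set (SO_val g)^T.
Proof.
have [/= gg dg] := set_valP g; split; last by rewrite det_tr.
by rewrite trmxK; exact: mulmx1C.
Qed.

Definition SO_one : SO R m := SigSub (mem_set SO_set1).
Definition SO_mul g h : SO R m := SigSub (mem_set (SO_setM g h)).
Definition SO_inv g : SO R m := SigSub (mem_set (SO_setV g)).

Lemma SO_mulA : associative SO_mul.
Proof. by move=> a b c; apply: SO_val_inj; exact: mulmxA. Qed.

Lemma SO_mul1g : left_id SO_one SO_mul.
Proof. by move=> a; apply: SO_val_inj; exact: mul1mx. Qed.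

Lemma SO_mulg1 : right_id SO_one SO_mul.
Proof. by move=> a; apply: SO_val_inj; exact: mulmx1. Qed.

Lemma SO_mulgV : right_inverse SO_one SO_inv SO_mul.
Proof. by move=> a; apply: SO_val_inj; have [] := set_valP a. Qed.

Lemma SO_mulVg : left_inverse SO_one SO_inv SO_mul.
Proof.
by move=> a; apply: SO_val_inj; apply: mulmx1C; have [] := set_valP a.
Qed.

End SO_group.

HB.instance Definition _ (R : realType) (m : nat) :=
  isPointed.Build (SO R m) (SO_one R m).

HB.instance Definition _ (R : realType) (m : nat) :=
  isGroup.Build (SO R m) (@SO_mulA R m) (@SO_mul1g R m) (@SO_mulg1 R m)
    (@SO_mulVg R m) (@SO_mulgV R m).

(* SO(m) with its Borel sigma-algebra *)
Notation borel_SO R m := (g_sigma_algebraType (@open (SO R m))).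

(* SO(m) is a compact second-countable group: regularity is automatic for a
   Borel probability measure, and the left-invariant one is unique and also
   right-invariant. *)
Definition is_haar (R : realType) (m : nat)
    (P : probability (borel_SO R m) R) : Prop :=
  forall (h : SO R m) (B : set (borel_SO R m)), measurable B ->
    P [set (h * g)%g | g in B] = P B.

(* Main.v *)
(** Stein's method with integration by parts on the group. Let X_ij = E_ij - E_ji, N = 2n + 1 and
    W = tr g. Invariance of Haar measure under the rotations in the plane (i, j) shows that the
    derivative of any function in the direction X_ij has mean zero. Applying this to
    tr(X_ij g) f(W) and summing over i, j gives
      (N - 1) E[W f(W)] = E[(N - tr g^2) f'(W)],
    so for the solution f of the Stein equation f'(x) - x f(x) = 1_{x <= a} - Phi(a),
      P(W <= a) - Phi(a) = E[f'(W) (tr g^2 - 1)] / (N - 1).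
    Since |f'| <= 1 it remains to bound E|tr g^2 - 1| by sqrt 8, and E (tr g^2 - 1)^2 <= 8 follows
    from the same integration by parts applied to tr(X_ij g) W, tr(X_ij g^2) and
    tr(X_ij g^2) tr g^2. The function f is not differentiable at a: there f' is read as the mean of
    the one-sided derivatives, the error is odd in X_ij and cancels in the sum, and the indicator of
    x <= a gets the value 1/2 at x = a. The indicator itself is recovered by letting a decrease. *)

Require Import Defs.
From HB Require Import structures.
From mathcomp Require Import all_boot all_order all_algebra.
From mathcomp Require Import all_classical all_reals all_analysis.
From mathcomp Require Import measurable_realfun ring lra.

Set Implicit Arguments.
Unset Strict Implicit.
Unset Printing Implicit Defensive.

Import Order.TTheory GRing.Theory Num.Theory.
Import numFieldNormedType.Exports.

Local Open Scope classical_set_scope.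
Local Open Scope ring_scope.

(** * The Gaussian integral and the Stein equation *)

Section gaussian.
Context {R : realType}.
Implicit Types x y a : R.
Local Notation mu := (@lebesgue_measure R).

Definition gauss x := expR (- (x ^+ 2 / 2)).
Definition gauss_int x := \int[mu]_(t in `]-oo, x]) gauss t.
Local Notation psi := gauss_int.
Local Notation Z := (Num.sqrt (2 * pi) : R).

Lemma gauss_gt0 x : 0 < gauss x.
Proof. exact: expR_gt0. Qed.

Lemma gaussN x : gauss (- x) = gauss x.
Proof. by rewrite /gauss sqrrN. Qed.

Lemma gauss_le1 x : gauss x <= 1.
Proof. by rewrite -expR0 ler_expR oppr_le0 divr_ge0 ?sqr_ge0. Qed.

Lemma sqrt_2pi_gt0 : 0 < Z.
Proof. by rewrite sqrtr_gt0 mulr_gt0 ?pi_gt0. Qed.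

(** Integrability and total mass of [gauss] are inherited from the normal density through this
    factorization. *)
Lemma gaussE x : gauss x = Z * normal_pdf 0 1 x.
Proof.
rewrite normal_pdfE ?oner_neq0// /normal_peak /normal_fun /gauss.
rewrite expr1n !mul1r mulr_natl subr0 mulrA divff ?mul1r ?mulNr//.
by rewrite -[pi *+ 2]mulr_natl gt_eqF ?sqrt_2pi_gt0.
Qed.

Lemma integrable_gauss (A : set R) : measurable A ->
  mu.-integrable A (EFin \o gauss).
Proof.
move=> mA; apply: (@integrableS _ _ _ mu setT) => //.
rewrite (_ : _ \o _ = fun x => (Z%:E * (normal_pdf 0 1 x)%:E)%E); last first.
  by apply/funext => x; rewrite /= gaussE EFinM.
by apply: integrableZl => //; exact: integrable_normal_pdf.
Qed.

Lemma is_derive_gauss x : is_derive x 1 gauss (- x * gauss x).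
Proof.
rewrite /gauss; apply: is_derive_eq.
by rewrite /GRing.scale/=; field.
Qed.

Lemma continuous_gauss : continuous gauss.
Proof.
move=> x; apply: differentiable_continuous; apply/derivable1_diffP.
by have [] := is_derive_gauss x.
Qed.

Lemma is_derive_gauss_int x : is_derive x 1 psi (gauss x).
Proof.
have xx1 : x < x + 1 by rewrite ltrDl.
have [] := @continuous_FTC1 R gauss -oo%O x _ xx1.
- exact: integrable_gauss.
- exact: ltNyr.
- exact: continuous_gauss.
- move=> d1 d2; by apply: DeriveDef => //; rewrite -derive1E.
Qed.

Lemma gauss_int_ge0 x : 0 <= psi x.
Proof. by apply: Rintegral_ge0 => t _; exact/ltW/gauss_gt0. Qed.

Lemma gauss_integralT : \int[mu]_t gauss t = Z.
Proof.
under eq_Rintegral do rewrite gaussE.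
rewrite RintegralZl//; last exact: integrable_normal_pdf.
by rewrite /Rintegral integral_normal_pdf /= mulr1.
Qed.

Lemma gauss_tail x : \int[mu]_(t in `[x, +oo[) gauss t = Z - psi x.
Proof.
rewrite -gauss_integralT -set_itvNyy Rintegral_itvB//; last exact: integrable_gauss.
by rewrite Rintegral_itv_obnd_cbnd//; exact: integrable_gauss.
Qed.

Lemma gauss_intN x : psi (- x) = Z - psi x.
Proof.
rewrite -gauss_tail /psi /Rintegral; congr fine.
rewrite ge0_integration_by_substitutionNy.
- by apply: eq_integral => t _; rewrite /= gaussN.
- by apply: continuous_subspaceT; exact: continuous_gauss.
- by move=> t _; exact/ltW/gauss_gt0.
Qed.

Lemma gauss_int_le x y : x <= y -> psi x <= psi y.
Proof.
move=> xy; rewrite -subr_ge0 /psi Rintegral_itvB//; last exact: integrable_gauss.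
by apply: Rintegral_ge0 => t _; exact/ltW/gauss_gt0.
Qed.

Lemma cvg_gauss : gauss x @[x --> +oo] --> (0 : R).
Proof.
apply: (@cvg_comp _ _ _ (fun x : R => x ^+ 2 / 2) (fun x : R => expR (- x)) _ +oo).
  apply/cvgryPge => A; near=> x.
  have x1 : 1 <= x by near: x; apply: nbhs_pinfty_ge; exact: num_real.
  have xA : 2 * A <= x by near: x; apply: nbhs_pinfty_ge; exact: num_real.
  nra.
exact: cvgr_expR.
Unshelve. all: by end_near. Qed.

(** The Mills ratio bound. For x > 0, [psi (- x)] is the integral of [gauss] over t >= x, where x
    gauss(t) <= t gauss(t), and the latter has antiderivative - gauss(t). For x <= 0 the left side
    is not positive. *)
Lemma mills x : x * psi (- x) <= gauss x.
Proof.
have [x0|x0] := leP x 0.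
  apply: (@le_trans _ _ 0); last exact/ltW/gauss_gt0.
  by rewrite mulr_le0_ge0 ?gauss_int_ge0.
rewrite gauss_intN -gauss_tail.
have g0 (t : R) : x <= t -> (0 <= t * gauss t).
  by move=> xt; rewrite mulr_ge0 ?ltW ?gauss_gt0//; lra.
have cg : continuous (fun t : R => t * gauss t).
  by move=> t; apply: cvgM; [exact: cvg_id|exact: continuous_gauss].
have dN (t : R) : is_derive t 1 (fun u : R => - gauss u)  (t * gauss t).
  have := is_derive_gauss t => ?.
  by apply: is_derive_eq; rewrite mulNr opprK.
have FTC : (\int[mu]_(t in `[x, +oo[) (t * gauss t)%:E = (gauss x)%:E)%E.
  rewrite (@ge0_continuous_FTC2y _ _ (fun u : R => - gauss u) _ 0).
  - by rewrite -EFinB sub0r opprK.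
  - by [].
  - exact: continuous_subspaceT.
  - by rewrite -oppr0; apply: cvgN; exact: cvg_gauss.
  - by move=> t _; have [] := dN t.
  - by apply: cvg_at_right_filter; apply: cvgN; exact: continuous_gauss.
  - by move=> t _; rewrite derive1E; have [_ ->] := dN t.
rewrite -RintegralZl//; last exact: integrable_gauss.
rewrite -[leRHS]/(fine (gauss x)%:E) -FTC; apply: le_Rintegral => //.
- rewrite (_ : _ \o _ = fun t => (x%:E * (gauss t)%:E)%E)//.
  by apply: integrableZl => //; exact: integrable_gauss.
- apply/integrableP; split.
    apply/measurable_EFinP; apply: measurable_funTS.
    exact: continuous_measurable_fun.
  rewrite (_ : (\int[_]_(_ in _) _)%E = (gauss x)%:E) ?ltry//.
  rewrite -FTC; apply: eq_integral => t; rewrite inE/= in_itv/= andbT => xt.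
  by rewrite ger0_norm// g0.
- move=> t; rewrite /= in_itv/= andbT => xt.
  by rewrite ler_pM2r ?gauss_gt0.
Qed.

Definition Gauss_cdf x := Z^-1 * psi x.
Local Notation Phi := Gauss_cdf.

Lemma Gauss_cdf_ge0 x : 0 <= Phi x.
Proof. by rewrite mulr_ge0 ?invr_ge0 ?gauss_int_ge0 ?ltW ?sqrt_2pi_gt0. Qed.

Lemma Gauss_cdfN x : Phi (- x) = 1 - Phi x.
Proof. by rewrite /Phi gauss_intN mulrBr mulVf// gt_eqF ?sqrt_2pi_gt0. Qed.

Lemma Gauss_cdf_le x y : x <= y -> Phi x <= Phi y.
Proof.
by move=> xy; rewrite ler_pM2l ?invr_gt0 ?sqrt_2pi_gt0// gauss_int_le.
Qed.

(** The normal density is at most 1, because [gauss] is and Z >= 1. This controls the loss when the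
    threshold is moved slightly to the right. *)
Lemma Gauss_cdf_lipschitz x y : x <= y -> Phi y <= Phi x + (y - x).
Proof.
move=> xy; rewrite /Phi -lerBlDl -mulrBr ler_pdivrMl ?sqrt_2pi_gt0//.
have Z1 : 1 <= Z.
  rewrite -[leLHS]sqrtr1 ler_wsqrtr//.
  have := @pi_ge2 R; lra.
apply: (@le_trans _ _ (y - x)); last by rewrite ler_peMl// subr_ge0.
rewrite Rintegral_itvB//; last exact: integrable_gauss.
apply: (@le_trans _ _ (\int[mu]_(t in `]x, y]) 1)).
  apply: le_Rintegral => //; first exact: integrable_gauss.
    apply: (@integrableS _ _ _ mu `[x, y]) => //.
      exact: subset_itv_oc_cc.
    apply: continuous_compact_integrable; first exact: segment_compact.
    by apply: continuous_subspaceT => ?; exact: cvg_cst.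
  by move=> t _; exact: gauss_le1.
rewrite Rintegral_cst// mul1r.
rewrite [X in fine X](lebesgue_measure_itv `]x, y])/= lte_fin.
by case: ltP => //= _; rewrite subr_ge0.
Qed.

End gaussian.

(** * The Stein solution and the bound on its derivative *)

Section stein_solution.
Context {R : realType}.
Implicit Types x y a : R.
Local Notation Phi := Gauss_cdf.
Local Notation psi := gauss_int.
Local Notation Z := (Num.sqrt (2 * pi) : R).

(* [Num.sg 0 = 0], so the value at [x = a] is 1/2. *)
Definition half_step a x : R := (1 - Num.sg (x - a)) / 2.

(** The integral of (1_{t <= a} - Phi(a)) gauss(t) over t <= x, divided by gauss(x); [Num.min] comes
    from the indicator. *)
Definition stein_sol a x :=
  expR (x ^+ 2 / 2) * (psi (Num.min x a) - Phi a * psi x).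

(* The derivative of [stein_sol a], read off the Stein equation; at [x = a] it is
   the mean of the two one-sided derivatives. *)
Definition stein_der a x := x * stein_sol a x + (half_step a x - Phi a).

Lemma gauss_int_Phi x : psi x = Z * Phi x.
Proof. by rewrite /Gauss_cdf mulVKf// gt_eqF// sqrt_2pi_gt0. Qed.

Lemma expR_gauss x : expR (x ^+ 2 / 2) = (gauss x)^-1.
Proof. by rewrite /gauss expRN invrK. Qed.

(** The bounded term is the derivative of the Stein solution to the left of a. Put r = x psi(x) /
    gauss(x). Mills at - x gives r >= -1, hence the lower bound. The upper bound is clear when r <=
    0; for x > 0, Mills at x and 1 - Phi(a) <= 1 - Phi(x) give (1 - Phi(a)) r <= Phi(x) <=
    Phi(a). *)
Lemma stein_left_bound a x : x <= a ->
  0 <= (1 - Phi a) * (x * ((gauss x)^-1 * psi x) + 1) <= 1.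
Proof.
move=> xa; have g0 := gauss_gt0 x.
have i0 : 0 <= (gauss x)^-1 by rewrite invr_ge0 ltW.
have p1 : 0 <= 1 - Phi a by rewrite -Gauss_cdfN Gauss_cdf_ge0.
have p0 := Gauss_cdf_ge0 a; have q0 := Gauss_cdf_ge0 x.
have qp := Gauss_cdf_le xa.
set r := x * _.
have rE : r = x * psi x / gauss x by rewrite /r; field; rewrite gt_eqF.
have r1 : - 1 <= r.
  rewrite rE ler_pdivlMr// mulN1r lerNl -mulNr.
  by have := mills (- x); rewrite opprK gaussN.
apply/andP; split; first nra.
have [x0|x0] := leP x 0.
  have : r <= 0.
    by rewrite rE mulr_le0_ge0// mulr_le0_ge0// gauss_int_ge0.
  nra.
have Mx := mills x; rewrite [psi (- x)]gauss_int_Phi Gauss_cdfN in Mx.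
have s1 : x * Z / gauss x * (1 - Phi x) <= 1.
  have -> : x * Z / gauss x * (1 - Phi x) = x * (Z * (1 - Phi x)) / gauss x.
    by field; rewrite gt_eqF.
  by rewrite ler_pdivrMr// mul1r.
rewrite gauss_int_Phi in rE.
have {}rE : r = x * Z / gauss x * Phi x by rewrite rE; field; rewrite gt_eqF.
have t0 : 0 <= x * Z / gauss x by rewrite !mulr_ge0// ltW// sqrt_2pi_gt0.
move: rE s1 t0; set t := x * Z / gauss x => rE s1 t0.
have : (1 - Phi a) * r <= Phi x.
  rewrite rE; apply: (@le_trans _ _ ((1 - Phi x) * (t * Phi x))).
    by apply: ler_wpM2r; [exact: mulr_ge0|lra].
  have -> : (1 - Phi x) * (t * Phi x) = (t * (1 - Phi x)) * Phi x by ring.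
  by rewrite -[leRHS]mul1r ler_wpM2r.
lra.
Qed.

(** The derivative to the right of a, obtained from the left case by the reflection x -> - x, a -> -
    a. *)
Lemma stein_right_bound a x : a <= x ->
  -1 <= Phi a * (x * ((gauss x)^-1 * psi (- x)) - 1) <= 0.
Proof.
move=> ax; have := @stein_left_bound (- a) (- x); rewrite lerN2 => /(_ ax).
rewrite gaussN Gauss_cdfN opprB [1 + _]addrC subrK.
rewrite (_ : Phi a * _ = - (Phi a * (- x * ((gauss x)^-1 * psi (- x)) + 1))).
  by move/andP => [h1 h2]; apply/andP; split; lra.
by ring.
Qed.

Lemma stein_der_bound a x : `|stein_der a x| <= 1.
Proof.
have Pa : psi a - Phi a * psi a = Phi a * psi (- a).
  by rewrite gauss_intN gauss_int_Phi; ring.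
rewrite /stein_der /stein_sol /half_step expR_gauss.
have [xa|ax|->] := ltgtP x a.
- rewrite ltr0_sg ?subr_lt0// opprK.
  have := stein_left_bound (ltW xa).
  rewrite (_ : _ * (_ + 1) = x * ((gauss x)^-1 * (psi x - Phi a * psi x)) +
    ((1 + 1) / 2 - Phi a)); last by field; rewrite gt_eqF ?gauss_gt0.
  by move/andP => [h1 h2]; rewrite ler_norml h2 andbT; lra.
- rewrite gtr0_sg ?subr_gt0// subrr mul0r.
  have := stein_right_bound (ltW ax).
  rewrite (_ : _ * (_ - 1) = x * ((gauss x)^-1 * (psi a - Phi a * psi x)) +
    (0 - Phi a)).
    by move/andP => [h1 h2]; rewrite ler_norml h1/=; lra.
  by rewrite gauss_intN [psi a]gauss_int_Phi; field; rewrite gt_eqF ?gauss_gt0.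
(* At the kink the value is the average of the left expression, in [0, 1], and the right one, in
   [-1, 0]. *)
- rewrite subrr sgr0 subr0.
  rewrite ler_norml (_ : _ + _ =
    ((1 - Phi a) * (a * ((gauss a)^-1 * psi a) + 1) +
     Phi a * (a * ((gauss a)^-1 * psi (- a)) - 1)) / 2).
    move: (stein_left_bound (lexx a)) (stein_right_bound (lexx a)).
    move: ((1 - _) * _) (Phi a * _) => s t /andP[h1 h2] /andP[h3 h4].
    by apply/andP; split; lra.
  by rewrite gauss_intN gauss_int_Phi; field; rewrite gt_eqF ?gauss_gt0.
Qed.

End stein_solution.

(** * Skew-symmetric matrices and plane rotations *)

Section skew_matrices.
Context {R : realType} {N : nat}.
Implicit Types (A B X : 'M[R]_N) (i j k l : 'I_N) (a b c d t : R).

Definition skew i j : 'M[R]_N := delta_mx i j - delta_mx j i.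

Lemma skewC i j : skew j i = - skew i j.
Proof. by rewrite /skew opprB. Qed.

Lemma tr_skew i j : (skew i j)^T = - skew i j.
Proof. by rewrite /skew linearB/= !trmx_delta opprB. Qed.

(** For distinct i and j the square is minus the projection onto the plane (i, j); for i = j
    everything vanishes. *)
Lemma skew_cube i j : skew i j *m skew i j *m skew i j = - skew i j.
Proof.
rewrite /skew; have [->|ij] := eqVneq i j; first by rewrite subrr !mulmx0 oppr0.
have ji : (j == i) = false by rewrite eq_sym (negbTE ij).
rewrite !(mulmxBl, mulmxBr) !(mul_delta_mx_cond, eqxx, negbTE ij, ji).
rewrite !(mulr0n, mulr1n, sub0r, subr0, mul0mx, mulmx0, opprK, mulNmx, mulmxN).
by rewrite addr0 opprB addrC.
Qed.

Lemma mulmx_delta A i j k l :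
  delta_mx i j *m A *m delta_mx k l = A j k *: (delta_mx i l : 'M[R]_N).
Proof.
apply/matrixP => u v; rewrite !mxE (bigD1 k)//= big1 ?addr0; last first.
  by move=> w wk; rewrite [delta_mx k l w v]mxE (negbTE wk) mulr0.
rewrite !mxE (bigD1 j)//= big1 ?addr0; last first.
  by move=> w wj; rewrite !mxE (negbTE wj) andbF mul0r.
by rewrite !mxE !eqxx andbT/=; case: (u == i); case: (v == l);
  rewrite /= ?mulr0 ?mul0r ?mulr1 ?mul1r.
Qed.

Lemma mxtrace_delta A i j : \tr (delta_mx i j *m A) = A j i.
Proof.
rewrite /mxtrace (bigD1 i)//= big1 ?addr0; last first.
  by move=> w wi; rewrite !mxE big1// => u _; rewrite !mxE (negbTE wi) mul0r.
rewrite !mxE (bigD1 j)//= big1 ?addr0; last first.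
  by move=> w wj; rewrite !mxE (negbTE wj) andbF mul0r.
by rewrite !mxE !eqxx mul1r.
Qed.

Lemma mxtrace_skew A i j : \tr (skew i j *m A) = A j i - A i j.
Proof. by rewrite mulmxBl linearB/= !mxtrace_delta. Qed.

Lemma sum_mxtrace_tr A B : \sum_i \sum_j A i j * B i j = \tr (A *m B^T).
Proof.
by rewrite /mxtrace; apply: eq_bigr => i _; rewrite !mxE; apply: eq_bigr => j _; rewrite mxE.
Qed.

Lemma sum_mxtrace A B : \sum_i \sum_j A i j * B j i = \tr (A *m B).
Proof. by rewrite /mxtrace; apply: eq_bigr => i _; rewrite !mxE. Qed.

(** The sum runs over ordered pairs, so each plane is counted twice; this is the source of the
    factor 2 here and below. *)
Lemma skew_contract2 A B :
  \sum_i \sum_j \tr (skew i j *m A) * \tr (skew i j *m B)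
  = 2 * (\tr (A *m B^T) - \tr (A *m B)).
Proof.
under eq_bigr do under eq_bigr do rewrite !mxtrace_skew.
rewrite -sum_mxtrace_tr -sum_mxtrace mulr_natl mulr2n.
rewrite [X in _ = (X - _) + _]exchange_big [X in _ = (_ - X) + _]exchange_big/=.
rewrite -!sumrB -big_split/=; apply: eq_bigr => i _.
rewrite -!sumrB -big_split/=; apply: eq_bigr => j _; ring.
Qed.

Lemma skew_contract A B :
  \sum_i \sum_j \tr (skew i j *m A *m (skew i j *m B))
  = 2 * (\tr (A *m B^T) - \tr A * \tr B).
Proof.
have trE i j : \tr (skew i j *m A *m (skew i j *m B)) =
    A j i * B j i - A j j * B i i - (A i i * B j j - A i j * B i j).
  rewrite mulmxA /skew !(mulmxBl, mulmxBr) !linearB/= !mulmx_delta.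
  by rewrite -!scalemxAl !linearZ/= !mxtrace_delta /GRing.scale/=; ring.
under eq_bigr do under eq_bigr do rewrite trE.
have -> : \tr A * \tr B = \sum_i \sum_j A i i * B j j.
  by rewrite /mxtrace mulr_suml; apply: eq_bigr => i _; rewrite mulr_sumr.
rewrite -sum_mxtrace_tr mulr_natl mulr2n.
rewrite [X in _ = (X - _) + _]exchange_big [X in _ = (_ - X) + _]exchange_big/=.
rewrite -!sumrB -big_split/=; apply: eq_bigr => i _.
rewrite -!sumrB -big_split/=; apply: eq_bigr => j _; ring.
Qed.

(** * Cayley parametrization of plane rotations *)

Section cayley.
Variable X : 'M[R]_N.
Hypotheses (XT : X^T = - X) (X3 : X *m X *m X = - X).

(** Since X^3 = - X, these polynomials in X are closed under product, so matrix identities reduce to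
    identities between coefficients. *)
Definition quad a b : 'M[R]_N := 1%:M + a *: X + b *: (X *m X).

Lemma quadM a b c d :
  quad a b *m quad c d = quad (a + c - a * d - b * c) (b + d + a * c - b * d).
Proof.
rewrite /quad !(mulmxDl, mulmxDr) !mul1mx !mulmx1 -!scalemxAl -!scalemxAr.
rewrite !scalerA !mulmxA X3 !mulNmx !scalerN.
apply/matrixP => u v; rewrite !mxE; ring.
Qed.

Lemma quad00 : quad 0 0 = 1%:M.
Proof. by rewrite /quad !scale0r !addr0. Qed.

Lemma tr_quad a b : (quad a b)^T = quad (- a) b.
Proof.
by rewrite /quad !linearD/= !linearZ/= trmx1 trmx_mul XT mulNmx mulmxN opprK
  scalerN scaleNr.
Qed.

(* (1 + t X) (1 - t X)^-1, using X^3 = - X to expand the inverse. *)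
Definition cayley t := quad (2 * t / (1 + t ^+ 2)) (2 * t ^+ 2 / (1 + t ^+ 2)).

(** Here t is the tangent of half the angle, so the coefficients are rational. For the determinant,
    (1 - t X) cayley(t) = 1 + t X is the transpose of 1 - t X, whose determinant is nonzero by the
    explicit inverse in [inv] and can be cancelled. *)
Lemma cayley_SO t : SO_set (cayley t).
Proof.
have t1 : 1 + t ^+ 2 != 0 by rewrite gt_eqF// ltr_pwDl// sqr_ge0.
split; rewrite /cayley.
  by rewrite tr_quad quadM -quad00; congr quad; field.
have inv : quad (- t) 0 *m quad (t / (1 + t ^+ 2)) (t ^+ 2 / (1 + t ^+ 2)) = 1%:M.
  by rewrite quadM -quad00; congr quad; field.
have det0 : \det (quad (- t) 0) != 0.
  apply/negP => /eqP d0; move/(congr1 determinant): inv.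
  by rewrite det_mulmx d0 mul0r det1 => /esym/eqP; rewrite oner_eq0.
apply: (mulfI det0); rewrite -det_mulmx mulr1 quadM -det_tr tr_quad.
by congr (\det (quad _ _)); field.
Qed.

(** With 2 t factored out exactly, the remaining factor is bounded and tends to the entry of X A;
    this supplies both the Lipschitz bound and the derivative. *)
Lemma cayley_entry t A u v : (cayley t *m A) u v - A u v =
  2 * t * ((1 + t ^+ 2)^-1 * (X *m A) u v +
           t * (1 + t ^+ 2)^-1 * (X *m X *m A) u v).
Proof.
have t1 : 1 + t ^+ 2 != 0 by rewrite gt_eqF// ltr_pwDl// sqr_ge0.
rewrite /cayley /quad !mulmxDl mul1mx -!scalemxAl.
by move: (X *m A) (X *m X *m A) => Y Y2; rewrite !mxE; field.
Qed.

End cayley.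

Lemma orthogonal_entry_le1 A i j : A *m A^T = 1%:M -> `|A i j| <= 1.
Proof.
move=> /matrixP/(_ i i); rewrite !mxE eqxx mulr1n (bigD1 j)//= mxE => e.
rewrite -(@ler_pXn2r _ 2)// ?nnegrE// expr1n real_normK ?num_real// -e -expr2.
by rewrite lerDl sumr_ge0// => k _; rewrite mxE -expr2 sqr_ge0.
Qed.

Lemma orthogonal_mxtrace_le A : A *m A^T = 1%:M -> `|\tr A| <= N%:R.
Proof.
move=> oA; rewrite (le_trans (ler_norm_sum _ _ _))//.
rewrite (@le_trans _ _ (\sum_(i < N) 1))//; last by rewrite sumr_const card_ord.
by apply: ler_sum => i _; exact: orthogonal_entry_le1.
Qed.

Lemma orthogonalM A B : A *m A^T = 1%:M -> B *m B^T = 1%:M ->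
  (A *m B) *m (A *m B)^T = 1%:M.
Proof. by move=> oA oB; rewrite trmx_mul mulmxA -(mulmxA A) oB mulmx1. Qed.

End skew_matrices.

(** * Means with respect to Haar measure *)

Section matrix_limits.
Context {R : realType} {N : nat}.

Lemma cvg_sum_seq (T I : Type) (F : set_system T) {FF : Filter F} (s : seq I)
    (f : I -> T -> R) (a : I -> R) :
  (forall i, f i x @[x --> F] --> a i) ->
  \sum_(i <- s) f i x @[x --> F] --> \sum_(i <- s) a i.
Proof.
move=> fa; elim: s => [|i s IH].
  by rewrite big_nil; under eq_fun do rewrite big_nil; exact: cvg_cst.
by rewrite big_cons; under eq_fun do rewrite big_cons; exact: cvgD.
Qed.

Lemma cvg_mx_entries (T : Type) (F : set_system T) {FF : Filter F}
    (f : T -> 'M[R]_N) (A : 'M[R]_N) :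
  (forall i j, f x i j @[x --> F] --> A i j) -> f x @[x --> F] --> A.
Proof.
move=> fA B [U AU UB]; rewrite nbhs_simpl/=.
apply: (@filterS _ F _ [set x | forall i j, U i j (f x i j)]).
  by move=> x Ux; exact: UB.
by apply: filter_forall => i; apply: filter_forall => j; exact/fA/AU.
Qed.

Lemma continuous_SO_entry i j : continuous (fun g : SO R N => g i j).
Proof.
move=> g; apply: (@continuous_comp _ _ _ (@SO_val R N) (fun A : 'M[R]_N => A i j)).
  exact: initial_continuous.
exact: coord_continuous.
Qed.

Lemma continuous_SO_mul (h : SO R N) : continuous (fun g => h * g : SO R N)%g.
Proof.
apply: continuous_comp_initial => g.
have FF : Filter (nbhs g) by exact: nbhs_filter.
apply: (@cvg_mx_entries _ _ FF) => i j.
rewrite (_ : (fun x => _) = (fun x : SO R N => \sum_k h i k * x k j)).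
  rewrite [X in _ --> X](_ : _ = \sum_k h i k * (g : SO R N) k j); last by rewrite mxE.
  apply: (@cvg_sum_seq _ _ _ FF) => k; apply: cvgM; first exact: cvg_cst.
  exact: continuous_SO_entry.
by apply/funext => x; rewrite mxE.
Qed.

Lemma measurable_SO_entry i j :
  measurable_fun [set: borel_SO R N] (fun g : borel_SO R N => (g : SO R N) i j).
Proof.
apply: (measurability _ (RGenOpens.measurableE R)).
move=> _ [_ [a [b ->] <-]]; rewrite setTI; apply: sub_sigma_algebra.
move/continuousP: (@continuous_SO_entry i j); apply; exact: interval_open.
Qed.

Lemma measurable_SO_mul (h : SO R N) :
  measurable_fun [set: borel_SO R N] (fun g : borel_SO R N => (h * g)%g : borel_SO R N).
Proof.
apply: (@measurability _ _ (borel_SO R N) (borel_SO R N) _ _ (@open (SO R N))) => //.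
move=> _ [A oA <-]; rewrite setTI; apply: sub_sigma_algebra.
by move/continuousP: (@continuous_SO_mul h); apply.
Qed.

End matrix_limits.

Section mean.
Context {R : realType} {N : nat}.
Variable P : probability (borel_SO R N) R.
Implicit Types u v : borel_SO R N -> R.

(** This class is closed under sums and products and is integrable for any probability, so
    integrability never has to be argued separately. *)
Definition bmeas u :=
  measurable_fun [set: borel_SO R N] u /\ exists C, forall g, `|u g| <= C.

Definition mean u := \int[P]_g u g.

Lemma bmeas_integrable u : bmeas u -> P.-integrable setT (EFin \o u).
Proof.
move=> [mu [C uC]]; apply: measurable_bounded_integrable => //.
  by rewrite -ge0_fin_numE// fin_num_measure.
exists C; split; first exact: num_real.
by move=> x Cx g _; apply: le_trans (uC g) _; exact: ltW.
Qed.

Lemma bmeas_cst c : bmeas (fun=> c).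
Proof. by split; [exact: measurable_cst|exists `|c|]. Qed.

Lemma bmeasD u v : bmeas u -> bmeas v -> bmeas (fun g => u g + v g).
Proof.
move=> [mu [C uC]] [mv [D vD]]; split; first exact: measurable_funD.
by exists (C + D) => g; rewrite (le_trans (ler_normD _ _))// lerD.
Qed.

Lemma bmeasM u v : bmeas u -> bmeas v -> bmeas (fun g => u g * v g).
Proof.
move=> [mu [C uC]] [mv [D vD]]; split; first exact: measurable_funM.
by exists (C * D) => g; rewrite normrM ler_pM.
Qed.

Lemma bmeasN u : bmeas u -> bmeas (fun g => - u g).
Proof.
move=> bu; have := bmeasM (bmeas_cst (-1)) bu.
by congr bmeas; apply/funext => g; rewrite mulN1r.
Qed.

Lemma bmeas_sum (I : Type) (s : seq I) (F : I -> borel_SO R N -> R) :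
  (forall i, bmeas (F i)) -> bmeas (fun g => \sum_(i <- s) F i g).
Proof.
move=> bF; elim: s => [|i s IH].
  have := bmeas_cst 0; congr bmeas.
  by apply/funext => g; rewrite big_nil.
have := bmeasD (bF i) IH; congr bmeas.
by apply/funext => g; rewrite big_cons.
Qed.

Lemma meanD u v : bmeas u -> bmeas v ->
  mean (fun g => u g + v g) = mean u + mean v.
Proof. by move=> bu bv; rewrite /mean RintegralD//; exact: bmeas_integrable. Qed.

Lemma meanZ c u : bmeas u -> mean (fun g => c * u g) = c * mean u.
Proof. by move=> bu; rewrite /mean RintegralZl//; exact: bmeas_integrable. Qed.

Lemma mean_cst c : mean (fun=> c) = c.
Proof. by rewrite /mean Rintegral_cst// [X in fine X](probability_setT P) mulr1. Qed.

Lemma mean_sum (I : Type) (s : seq I) (F : I -> borel_SO R N -> R) :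
  (forall i, bmeas (F i)) ->
  mean (fun g => \sum_(i <- s) F i g) = \sum_(i <- s) mean (F i).
Proof.
move=> bF; elim: s => [|i s IH].
  rewrite big_nil -[RHS](mean_cst 0); congr mean.
  by apply/funext => g; rewrite big_nil.
rewrite big_cons -IH -meanD//; last exact: bmeas_sum.
by congr mean; apply/funext => g; rewrite big_cons.
Qed.

Lemma mean_le u v : bmeas u -> bmeas v -> (forall g, u g <= v g) ->
  mean u <= mean v.
Proof. by move=> bu bv uv; apply: le_Rintegral => //; exact: bmeas_integrable. Qed.

Lemma mean_haar (h : SO R N) u : is_haar P -> bmeas u ->
  mean (fun g => u (h * g)%g) = mean u.
Proof.
move=> haarP bu; have [mu [C uC]] := bu.
have mh := measurable_SO_mul h.
have bh : bmeas (fun g => u (h * g)%g).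
  by split; [exact: (measurableT_comp mu mh)|exists C].
have PE : forall A, measurable A -> pushforward P (fun g => (h * g)%g : borel_SO R N) A = P A.
  (* [is_haar] speaks of images; the preimage under translation by h is the image under translation
     by its inverse. *)
  move=> A mA; rewrite /pushforward/= -(haarP h^-1%g _ mA); congr (P _).
  apply/seteqP; split => [g Ag|_ [g Ag <-]].
    by exists (h * g)%g => //; rewrite mulgA mulVg mul1g.
  by rewrite /preimage/= mulgA mulgV mul1g.
rewrite /mean /Rintegral; congr fine.
transitivity (\int[pushforward P (fun g => (h * g)%g : borel_SO R N)]_g (u g)%:E)%E.
  rewrite integral_pushforward//; first exact/measurable_EFinP.
  exact: bmeas_integrable bh.
by apply: eq_measure_integral => A mA _; exact: PE.
Qed.

End mean.

(** * Differentiation along a sequence of translations *)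

Section mean_value.
Context {R : realType}.
Variables (f f' : R -> R).
Hypothesis df : forall x : R, is_derive x 1 f (f' x).

Lemma is_derive_continuous : continuous f.
Proof.
move=> x; apply: differentiable_continuous; apply/derivable1_diffP.
by have [] := df x.
Qed.

Lemma MVT_between x y : exists c,
  Num.min x y <= c <= Num.max x y /\ f y - f x = f' c * (y - x).
Proof.
have cf (A : set R) : {within A, continuous f}.
  exact/continuous_subspaceT/is_derive_continuous.
have [xy|/ltW yx] := leP x y.
- have [c cxy E] := MVT_segment xy (fun t _ => df t) (cf _).
  by exists c; split=> //; rewrite in_itv/= in cxy.
- have [c cxy E] := MVT_segment yx (fun t _ => df t) (cf _).
  exists c; split; first by rewrite in_itv/= in cxy.
  by apply: oppr_inj; rewrite opprB E -mulrN opprB.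
Qed.

End mean_value.

Section difference_quotients.
Context {R : realType} {N : nat}.
Variables (h : nat -> SO R N) (e : nat -> R).
Hypotheses (e_gt0 : forall k, 0 < e k) (e_cvg0 : e k @[k --> \oo] --> 0).
Implicit Types u v w : borel_SO R N -> R.

(* The sequence only approaches the identity from one side, so that |u - a| also
   has a derivative where u = a. *)
Definition derives u u' := [/\ bmeas u,
  exists C, forall g k, `|u (h k * g)%g - u g| <= C * e k &
  forall g, (u (h k * g)%g - u g) / e k @[k --> \oo] --> u' g].

Lemma derives_cst c : derives (fun=> c) (fun=> 0).
Proof.
split; first exact: bmeas_cst.
  by exists 0 => g k; rewrite subrr normr0 mul0r.
by move=> g; under eq_fun do rewrite subrr mul0r; exact: cvg_cst.
Qed.

Lemma derives_cvg u u' g : derives u u' -> u (h k * g)%g @[k --> \oo] --> u g.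
Proof.
move=> [_ _ /(_ g) ug].
have E : (fun k => u (h k * g)%g) = (fun k => (u (h k * g)%g - u g) / e k * e k + u g).
  by apply/funext => k; rewrite divfK ?subrK// gt_eqF.
rewrite E -[X in _ --> X]add0r -(mulr0 (u' g)).
by apply: cvgD; [exact: cvgM|exact: cvg_cst].
Qed.

Lemma derives_meas u u' : derives u u' ->
  forall k, measurable_fun setT (fun g : borel_SO R N => (u (h k * g)%g - u g) / e k).
Proof.
move=> [[mu _] _ _] k; apply: measurable_funM; last exact: measurable_cst.
apply: measurable_funB => //.
exact: (measurableT_comp mu (measurable_SO_mul (h k))).
Qed.

Lemma derives_bound u u' : derives u u' ->
  exists C, forall g k, `|(u (h k * g)%g - u g) / e k| <= C.
Proof.
move=> [_ [C uC] _]; exists C => g k.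
by rewrite normrM normfV (gtr0_norm (e_gt0 k)) ler_pdivrMr.
Qed.

Lemma derives_bmeas u u' : derives u u' -> bmeas u'.
Proof.
move=> du; have [C uC] := derives_bound du; have [_ _ ug] := du.
split; first by apply: (measurable_fun_cvg (derives_meas du)) => g _; exact: ug.
exists C => g; apply: (cvgr_to_le (cvg_norm (ug g))).
by apply: nearW => k; exact: uC.
Qed.

(** Each difference quotient has mean zero by invariance, and the Lipschitz bound lets dominated
    convergence carry this to the limit. *)
Lemma derives_mean0 (P : probability (borel_SO R N) R) u u' :
  is_haar P -> derives u u' -> mean P u' = 0.
Proof.
move=> haarP du; have [C uC] := derives_bound du; have [bu _ ug] := du.
pose D k g := (u (h k * g)%g - u g) / e k.
have bh k : bmeas (fun g => u (h k * g)%g).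
  have [mu [B uB]] := bu.
  by split; [exact: (measurableT_comp mu (measurable_SO_mul (h k)))|exists B].
have D0 k : mean P (D k) = 0.
  rewrite (_ : D k = fun g => (e k)^-1 * (u (h k * g)%g + - u g)).
    rewrite meanZ; last by apply: bmeasD => //; exact: bmeasN.
    rewrite meanD//; last exact: bmeasN.
    rewrite mean_haar// (_ : (fun g => - u g) = fun g => -1 * u g).
      by rewrite meanZ// mulN1r subrr mulr0.
    by apply/funext => g; rewrite mulN1r.
  by apply/funext => g; rewrite mulrC.
have bD k : bmeas (D k).
  by split; [exact: (derives_meas du)|exists C => g; exact: uC].
have [] := @dominated_convergence _ _ R P setT measurableT
  (fun k g => (D k g)%:E) (EFin \o u') (fun=> C%:E).
- by move=> k; apply/measurable_EFinP; exact: (derives_meas du).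
- by apply/measurable_EFinP; have [] := derives_bmeas du.
- by apply: aeW => g _; apply: cvg_EFin; [exact: nearW|exact: ug].
- exact: (bmeas_integrable P (bmeas_cst C)).
- by apply: aeW => g k _; rewrite lee_fin; exact: uC.
move=> _ _ /=.
have -> : (fun k => \int[P]_g (D k g)%:E)%E = (fun=> 0%E).
  apply/funext => k; have /fineK <- := integrable_fin_num measurableT (bmeas_integrable P (bD k)).
  by rewrite -[X in X%:E]/(mean P (D k)) D0.
move=> /cvg_unique U.
have := U _ _ (cvg_cst 0%E).
by rewrite /mean /Rintegral => -> //.
Qed.

Lemma derivesD u u' v v' : derives u u' -> derives v v' ->
  derives (fun g => u g + v g) (fun g => u' g + v' g).
Proof.
move=> [bu [C uC] du] [bv [D vD] dv]; split; first exact: bmeasD.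
  exists (C + D) => g k; rewrite mulrDl (_ : _ - _ =
    (u (h k * g)%g - u g) + (v (h k * g)%g - v g)); last by ring.
  by rewrite (le_trans (ler_normD _ _))// lerD.
move=> g; under eq_fun do rewrite opprD addrACA mulrDl.
exact: cvgD.
Qed.

Lemma derivesM u u' v v' : derives u u' -> derives v v' ->
  derives (fun g => u g * v g) (fun g => u' g * v g + u g * v' g).
Proof.
move=> du dv; have cv g := @derives_cvg _ _ g dv.
move: du dv => [bu [C uC] du] [bv [D vD] dv]; split; first exact: bmeasM.
  have [_ [A uA]] := bu; have [_ [B vB]] := bv.
  exists (C * B + A * D) => g k; rewrite (_ : _ - _ =
    (u (h k * g)%g - u g) * v (h k * g)%g + u g * (v (h k * g)%g - v g)); last by ring.
  rewrite (le_trans (ler_normD _ _))// [leRHS]mulrDl lerD// normrM.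
    by rewrite mulrAC ler_pM.
  by rewrite -mulrA ler_pM.
move=> g.
rewrite (_ : (fun k => _) = (fun k => (u (h k * g)%g - u g) / e k * v (h k * g)%g
   + u g * ((v (h k * g)%g - v g) / e k))).
  by apply: cvgD; apply: cvgM => //; exact: cvg_cst.
by apply/funext => k; ring.
Qed.

Lemma derivesZ c u u' : derives u u' ->
  derives (fun g => c * u g) (fun g => c * u' g).
Proof.
move=> du; have := derivesM (derives_cst c) du.
by congr derives; apply/funext => g; rewrite mul0r add0r.
Qed.

Lemma derives_sum (I : Type) (s : seq I) (F F' : I -> borel_SO R N -> R) :
  (forall i, derives (F i) (F' i)) ->
  derives (fun g => \sum_(i <- s) F i g) (fun g => \sum_(i <- s) F' i g).
Proof.
move=> dF; elim: s => [|i s IH].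
  have := derives_cst 0; congr derives.
    by apply/funext => g; rewrite big_nil.
  by apply/funext => g; rewrite big_nil.
have := derivesD (dF i) IH; congr derives.
  by apply/funext => g; rewrite big_cons.
by apply/funext => g; rewrite big_cons.
Qed.

Lemma derives_comp (f f' : R -> R) u u' :
  (forall x : R, is_derive x 1 f (f' x)) -> continuous f' ->
  (forall B, exists L, forall x, `|x| <= B -> `|f' x| <= L) ->
  derives u u' -> derives (fun g => f (u g)) (fun g => f' (u g) * u' g).
Proof.
move=> df cf' f'B du; have cu g := @derives_cvg _ _ g du.
move: du => [bu [C uC] du]; have [mu [B uB]] := bu.
have [L f'L] := f'B B.
have mvt g g' : exists c, [/\ `|c| <= B, `|c - u g| <= `|u g' - u g| &
    f (u g') - f (u g) = f' c * (u g' - u g)].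
  have [c [cI E]] := MVT_between df (u g) (u g'); exists c.
  move: cI (uB g) (uB g'); rewrite !ler_norml.
  have [gg|gg] := leP (u g) (u g') => /andP[c1 c2] /andP[g1 g2] /andP[g3 g4].
    rewrite (ger0_norm (_ : 0 <= u g' - u g)) ?subr_ge0//.
    split => //; apply/andP; split; lra.
  rewrite (ltr0_norm (_ : u g' - u g < 0)) ?subr_lt0//.
  by split => //; apply/andP; split; lra.
have L0 : 0 <= L := le_trans (normr_ge0 _) (f'L _ (uB point)).
have lip g g' : `|f (u g') - f (u g)| <= L * `|u g' - u g|.
  have [c [cB _ ->]] := mvt g g'.
  by rewrite normrM ler_wpM2r// f'L.
split.
- split.
    apply: (@measurableT_comp _ _ _ _ _ _ f) => //.
    by apply: continuous_measurable_fun; exact: is_derive_continuous df.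
  exists (`|f (u point)| + L * (B + B)) => g.
  rewrite -[f (u g)](subrK (f (u point))) addrC (le_trans (ler_normD _ _))//.
  rewrite lerD2l (le_trans (lip _ _))// ler_wpM2l ?L0//.
  by rewrite (le_trans (ler_normB _ _))// lerD.
- exists (L * C) => g k; rewrite (le_trans (lip _ _))// -mulrA.
  by rewrite ler_wpM2l ?L0.
- move=> g.
  (* The mean value points c k are squeezed towards u g, so f' (c k) converges by continuity. *)
  have /choice[c cP] k := mvt g (h k * g)%g.
  rewrite (_ : (fun k => _) = (fun k => f' (c k) * ((u (h k * g)%g - u g) / e k))).
    apply: cvgM; last exact: du.
    apply: continuous_cvg; first exact: cf'.
    apply/subr_cvg0/norm_cvg0P.
    have cu0 : `|u (h k * g)%g - u g| @[k --> \oo] --> (0 : R).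
      by apply/norm_cvg0P/subr_cvg0; exact: cu.
    apply: (@squeeze_cvgr _ _ _ _ (cst 0) (fun k => `|u (h k * g)%g - u g|)) => //.
      by apply: nearW => k; rewrite normr_ge0/=; have [] := cP k.
    exact: cvg_cst.
  by apply/funext => k; have [_ _ ->] := cP k; rewrite mulrA.
Qed.

(** Away from a the sign of u - a is eventually constant along the sequence. Where u = a the
    quotient is the absolute value of the quotient of u, because e k > 0. *)
Lemma derives_absB a u u' : derives u u' ->
  derives (fun g => `|u g - a|)
    (fun g => Num.sg (u g - a) * u' g + (u g == a)%:R * `|u' g|).
Proof.
move=> du; have cu g := @derives_cvg _ _ g du.
move: du => [[mu [B uB]] [C uC] du]; split.
- split; first by apply: measurableT_comp => //; exact: measurable_funB.
  exists (B + `|a|) => g.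
  by rewrite normr_id (le_trans (ler_normB _ _))// lerD.
- exists C => g k; apply: le_trans (uC g k).
  by rewrite (le_trans (ler_dist_dist _ _))// opprB addrA subrK.
- move=> g; have [uga|uga|uga] := ltgtP (u g) a.
  + rewrite ltr0_sg ?subr_lt0// mul0r addr0 mulN1r.
    apply: cvg_trans (cvgN (du g)); apply: near_eq_cvg.
    have : \forall k \near \oo, u (h k * g)%g < a.
      by apply: (cvgr_lt _ (cu g)).
    apply: filterS => k uk.
    rewrite (ltr0_norm (_ : u g - a < 0)) ?subr_lt0//.
    rewrite (ltr0_norm (_ : u _ - a < 0)) ?subr_lt0//.
    by transitivity (- ((u (h k * g)%g - u g) / e k)) => //; ring.
  + rewrite gtr0_sg ?subr_gt0// mul0r addr0 mul1r.
    apply: cvg_trans (du g); apply: near_eq_cvg.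
    have : \forall k \near \oo, a < u (h k * g)%g.
      by apply: (cvgr_gt _ (cu g)).
    apply: filterS => k uk.
    by rewrite (gtr0_norm (_ : 0 < u g - a)) ?subr_gt0//
      (gtr0_norm (_ : 0 < u _ - a)) ?subr_gt0//; congr (_ / _); ring.
  + rewrite uga subrr sgr0 mul0r add0r mul1r normr0.
    rewrite (_ : (fun k => _) = (fun k => `|(u (h k * g)%g - u g) / e k|)).
      exact: cvg_norm.
    by apply/funext => k; rewrite subr0 normrM normfV (gtr0_norm (e_gt0 k)) uga.
Qed.

Definition mx_derives (U U' : borel_SO R N -> 'M[R]_N) :=
  forall i j, derives (fun g => U g i j) (fun g => U' g i j).

Lemma mx_derives_cst A : mx_derives (fun=> A) (fun=> 0).
Proof.
move=> i j; have := derives_cst (A i j).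
by congr derives; apply/funext => g; rewrite mxE.
Qed.

Lemma mx_derivesM U U' V V' : mx_derives U U' -> mx_derives V V' ->
  mx_derives (fun g => U g *m V g) (fun g => U' g *m V g + U g *m V' g).
Proof.
move=> dU dV i j.
have := @derives_sum _ (index_enum _) _ _ (fun k => derivesM (dU i k) (dV k j)).
congr derives; apply/funext => g; first by rewrite mxE.
by rewrite !mxE -big_split.
Qed.

Lemma derives_mxtrace U U' : mx_derives U U' ->
  derives (fun g => \tr (U g)) (fun g => \tr (U' g)).
Proof. by move=> dU; apply: derives_sum => i; exact: dU. Qed.

End difference_quotients.

Ltac bmeas_tac :=
  repeat first [assumption | exact: bmeas_cst | apply: bmeasD | apply: bmeasM].

(** * Integration by parts on SO(N) *)

Section rotations.
Context {R : realType} {N : nat}.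
Implicit Types (i j : 'I_N) (k : nat) (g : SO R N).

(** The Cayley parameter [harmonic k] is 1 / (k + 1): it lies in (0, 1], k = 0 included, and tends
    to 0. *)
Definition rotation i j k : SO R N :=
  SigSub (mem_set (cayley_SO (tr_skew i j) (skew_cube i j) (harmonic k))).

(* [cayley X t = 1 + 2 t X + o(t)]. *)
Definition rot_step k : R := 2 * harmonic k.

Lemma rot_step_gt0 k : 0 < rot_step k.
Proof. by rewrite mulr_gt0// harmonic_gt0. Qed.

Lemma cvg_rot_step : rot_step k @[k --> \oo] --> 0.
Proof.
by rewrite -(mulr0 2); apply: cvgM; [exact: cvg_cst|exact: cvg_harmonic].
Qed.

Lemma SO_orthogonal g : g *m g^T = 1%:M.
Proof. by have [] := set_valP g. Qed.

Lemma bmeas_SO_entry i j : bmeas (fun g : borel_SO R N => (g : SO R N) i j).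
Proof.
split; first exact: measurable_SO_entry.
by exists 1 => g; exact: orthogonal_entry_le1 (SO_orthogonal g).
Qed.

Lemma mulmx_entry_bound (A : 'M[R]_N) g i j : `|(A *m g) i j| <= \sum_l `|A i l|.
Proof.
rewrite mxE (le_trans (ler_norm_sum _ _ _))//; apply: ler_sum => l _.
by rewrite normrM ler_piMr// orthogonal_entry_le1// SO_orthogonal.
Qed.

(** By [cayley_entry] the step cancels exactly and the X^2 term keeps a factor t that vanishes in
    the limit. Entries of g are at most 1 in absolute value, so the Lipschitz constant is uniform in
    g. *)
Lemma rotation_derives i j : mx_derives (rotation i j) rot_step
  (fun g : borel_SO R N => (g : SO R N)) (fun g : borel_SO R N => skew i j *m (g : SO R N)).
Proof.
set X := skew i j => u v.
pose t k : R := harmonic k.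
have t0 k : 0 < t k by exact: harmonic_gt0.
have t1 k : t k <= 1 by rewrite invf_le1// ler1n.
have s0 k : 0 < 1 + t k ^+ 2 by rewrite ltr_pwDl// sqr_ge0.
have ct : t k @[k --> \oo] --> (0 : R) by exact: cvg_harmonic.
have cs : (1 + t k ^+ 2)^-1 @[k --> \oo] --> (1 : R).
  have ct1 : 1 + t k ^+ 2 @[k --> \oo] --> (1 + 0 * 0 : R).
    by apply: cvgD; [exact: cvg_cst|exact: cvgM].
  rewrite -[X in _ --> X]invr1; apply: cvgV; first exact: oner_neq0.
  by move: ct1; rewrite mulr0 addr0.
have E g k : ((rotation i j k * g)%g : SO R N) u v - g u v = rot_step k *
    ((1 + t k ^+ 2)^-1 * (X *m g) u v + t k * (1 + t k ^+ 2)^-1 * (X *m X *m g) u v).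
  rewrite [((rotation i j k * g)%g : SO R N) u v](_ : _ = (cayley X (t k) *m g) u v)//.
  exact: cayley_entry.
split; first exact: bmeas_SO_entry.
  exists (\sum_l `|X u l| + \sum_l `|(X *m X) u l|) => g k.
  rewrite E normrM (gtr0_norm (rot_step_gt0 k)) mulrC ler_pM2r ?rot_step_gt0//.
  have i1 : (1 + t k ^+ 2)^-1 <= 1 by rewrite invf_le1// lerDl sqr_ge0.
  have i0 : 0 <= (1 + t k ^+ 2)^-1 by rewrite invr_ge0 ltW.
  rewrite (le_trans (ler_normD _ _))// lerD//.
    rewrite normrM ger0_norm// (le_trans _ (mulmx_entry_bound X g u v))//.
    by rewrite ler_piMl.
  have p0 : 0 <= t k * (1 + t k ^+ 2)^-1 by rewrite mulr_ge0// ltW.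
  rewrite normrM ger0_norm//.
  rewrite (le_trans _ (mulmx_entry_bound (X *m X) g u v))// ler_piMl//.
  by rewrite mulr_ile1// ltW.
move=> g; rewrite (_ : (fun k => _) = fun k => (1 + t k ^+ 2)^-1 * (X *m (g : SO R N)) u v +
    t k * (1 + t k ^+ 2)^-1 * (X *m X *m (g : SO R N)) u v); last first.
  by apply/funext => k; rewrite E mulrC mulKf// gt_eqF// rot_step_gt0.
have : (1 + t k ^+ 2)^-1 * (X *m (g : SO R N)) u v +
    t k * (1 + t k ^+ 2)^-1 * (X *m X *m (g : SO R N)) u v @[k --> \oo] -->
    (1 * (X *m (g : SO R N)) u v + 0 * 1 * (X *m X *m (g : SO R N)) u v : R).
  apply: cvgD; apply: cvgM; [exact: cs|exact: cvg_cst| |exact: cvg_cst].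
  exact: cvgM.
by rewrite mul1r mulr1 mul0r addr0.
Qed.

End rotations.

(** * Trace identities and moments from integration by parts *)

Section moments.
Context {R : realType} {N : nat}.
Variable P : probability (borel_SO R N) R.
Hypothesis haarP : is_haar P.
Implicit Types (i j : 'I_N) (g : SO R N).
Local Notation T := (borel_SO R N).
Local Notation drv i j := (derives (@rotation R N i j) rot_step).
Local Notation M := (N%:R - 1 : R).
Local Notation mean := (mean P).

Definition tr1 (g : T) : R := \tr (g : SO R N).
Definition tr2 (g : T) : R := \tr ((g : SO R N) *m (g : SO R N)).
Definition tr4 (g : T) : R :=
  \tr ((g : SO R N) *m (g : SO R N) *m ((g : SO R N) *m (g : SO R N))).
Local Notation dtr1 i j := (fun g : T => \tr (skew i j *m (g : SO R N))).
Local Notation dtr2 i j :=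
  (fun g : T => \tr (skew i j *m ((g : SO R N) *m (g : SO R N)))).

Lemma tr1_derives i j : drv i j tr1 (dtr1 i j).
Proof. exact: derives_mxtrace (rotation_derives i j). Qed.

Lemma dtr1_derives i j :
  drv i j (dtr1 i j) (fun g => \tr (skew i j *m 1%:M *m (skew i j *m (g : SO R N)))).
Proof.
have := derives_mxtrace (mx_derivesM rot_step_gt0 (cvg_rot_step (R := R))
  (mx_derives_cst _ _ (skew i j)) (rotation_derives i j)).
by congr derives; apply/funext => g; rewrite mul0mx add0r mulmx1.
Qed.

Lemma sqr_derives i j : mx_derives (rotation i j) rot_step
  (fun g : T => (g : SO R N) *m (g : SO R N))
  (fun g : T => skew i j *m (g : SO R N) *m (g : SO R N) +
     (g : SO R N) *m (skew i j *m (g : SO R N))).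
Proof.
exact: (mx_derivesM rot_step_gt0 (cvg_rot_step (R := R))
  (rotation_derives i j) (rotation_derives i j)).
Qed.

Lemma tr2_derives i j : drv i j tr2 (fun g => 2 * dtr2 i j g).
Proof.
have := derives_mxtrace (sqr_derives i j); congr derives; apply/funext => g.
by rewrite mxtraceD [X in _ + X]mxtrace_mulC -mulmxA; ring.
Qed.

Lemma dtr2_derives i j : drv i j (dtr2 i j)
  (fun g => \tr (skew i j *m 1%:M *m (skew i j *m ((g : SO R N) *m (g : SO R N)))) +
            \tr (skew i j *m (g : SO R N) *m (skew i j *m (g : SO R N)))).
Proof.
have := derives_mxtrace (mx_derivesM rot_step_gt0 (cvg_rot_step (R := R))
  (mx_derives_cst _ _ (skew i j)) (sqr_derives i j)).
by congr derives; apply/funext => g; rewrite mul0mx add0r mulmx1 mulmxDr mxtraceD !mulmxA.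
Qed.

Lemma bmeas_tr1 : bmeas tr1.
Proof. by apply: bmeas_sum => i; exact: bmeas_SO_entry. Qed.

Lemma bmeas_mxM (U V : T -> 'M[R]_N) : (forall i j, bmeas (fun g => U g i j)) ->
  (forall i j, bmeas (fun g => V g i j)) -> forall i j, bmeas (fun g => (U g *m V g) i j).
Proof.
move=> bU bV i j.
have := bmeas_sum (index_enum _) (fun k => bmeasM (bU i k) (bV k j)).
by congr bmeas; apply/funext => g; rewrite mxE.
Qed.

Lemma bmeas_tr2 : bmeas tr2.
Proof. by apply: bmeas_sum => i; apply: bmeas_mxM => *; exact: bmeas_SO_entry. Qed.

Lemma bmeas_tr4 : bmeas tr4.
Proof.
by apply: bmeas_sum => i; apply: bmeas_mxM => k l; apply: bmeas_mxM => *; exact: bmeas_SO_entry.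
Qed.

Lemma SO_orthogonal2 g : (g *m g) *m (g *m g)^T = 1%:M.
Proof. by apply: orthogonalM; exact: SO_orthogonal. Qed.

Lemma tr2_le (g : T) : `|tr2 g| <= N%:R.
Proof. exact: orthogonal_mxtrace_le (SO_orthogonal2 g). Qed.

Lemma tr4_le (g : T) : `|tr4 g| <= N%:R.
Proof.
by apply: orthogonal_mxtrace_le; apply: orthogonalM; exact: SO_orthogonal2.
Qed.

Lemma mean_sum_derives (u u' : 'I_N -> 'I_N -> T -> R) :
  (forall i j, drv i j (u i j) (u' i j)) ->
  mean (fun g => \sum_i \sum_j u' i j g) = 0.
Proof.
move=> du; have bu i j := derives_bmeas rot_step_gt0 (du i j).
rewrite mean_sum; last by move=> i; exact: bmeas_sum.
rewrite big1// => i _; rewrite mean_sum// big1// => j _.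
exact: (derives_mean0 rot_step_gt0 haarP (du i j)).
Qed.

(** The Casimir element: the squares of all [skew i j] add up to the scalar - 2 (N - 1). *)
Lemma skew_casimir (A : 'M[R]_N) :
  \sum_i \sum_j \tr (skew i j *m 1%:M *m (skew i j *m A)) = - (2 * M) * \tr A.
Proof. by rewrite skew_contract mul1mx mxtrace_tr mxtrace1; ring. Qed.

(** Exchanging i and j flips the sign of the first factor only, so the sum equals its own
    opposite. *)
Lemma skew_abs_sum0 g :
  \sum_i \sum_j dtr1 i j g * `|dtr1 i j g| = 0.
Proof.
set S := LHS; suff : S = - S by lra.
rewrite /S [LHS]exchange_big/= -sumrN; apply: eq_bigr => i _.
rewrite -sumrN; apply: eq_bigr => j _.
by rewrite skewC mulNmx linearN/= normrN mulNr.
Qed.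

Lemma mean_half_sum_derives (u u' : 'I_N -> 'I_N -> T -> R) (v : T -> R) :
  (forall i j, drv i j (u i j) (u' i j)) ->
  (forall g, \sum_i \sum_j u' i j g = 2 * v g) -> mean v = 0.
Proof.
move=> du uv; rewrite (_ : v = fun g => \sum_i \sum_j 2^-1 * u' i j g).
  apply: (@mean_sum_derives (fun i j g => 2^-1 * u i j g)) => i j.
  exact: (derivesZ rot_step_gt0 (cvg_rot_step (R := R))).
apply/funext => g; under eq_bigr do rewrite -mulr_sumr.
by rewrite -mulr_sumr uv mulKf.
Qed.

(* The term in [r] accounts for a kink of [F]; it is odd in [skew i j], hence cancels. *)
Lemma stein_identity (F Fc r : T -> R) :
  (forall i j, drv i j F (fun g => Fc g * dtr1 i j g + r g * `|dtr1 i j g|)) ->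
  mean (fun g => (N%:R - tr2 g) * Fc g - M * (tr1 g * F g)) = 0.
Proof.
move=> dF; have du i j := derivesM rot_step_gt0 (cvg_rot_step (R := R))
  (dtr1_derives i j) (dF i j).
apply: (mean_half_sum_derives du) => g; rewrite /=.
under eq_bigr do under eq_bigr do rewrite mulrDr !mulrA [_ * Fc g]mulrC [_ * r g]mulrC -!mulrA.
under eq_bigr do rewrite !big_split/= -mulr_suml -!mulr_sumr.
(* Differentiating the factor tr(X_ij g) yields - 2 M tr1 F; differentiating F yields 2 (N - tr2)
   Fc. *)
rewrite !big_split/= -mulr_suml -!mulr_sumr skew_casimir skew_contract2.
by rewrite skew_abs_sum0 SO_orthogonal mxtrace1 /tr1 /tr2; ring.
Qed.

(** Integration by parts for tr(X_ij g^2). *)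
Lemma mean_tr2E : mean (fun g => (N%:R - tr1 g ^+ 2) - M * tr2 g) = 0.
Proof.
apply: (mean_half_sum_derives dtr2_derives) => g; rewrite /=.
under eq_bigr do rewrite big_split/=.
rewrite big_split/= skew_casimir skew_contract SO_orthogonal mxtrace1.
by rewrite /tr1 /tr2; ring.
Qed.

(** Integration by parts for tr(X_ij g^2) tr g^2; the term in [tr4] comes from differentiating the
    second factor. *)
Lemma mean_tr2_sqrE :
  mean (fun g => (N%:R - tr1 g ^+ 2) * tr2 g + 2 * (N%:R - tr4 g) - M * tr2 g ^+ 2) = 0.
Proof.
have du i j := derivesM rot_step_gt0 (cvg_rot_step (R := R))
  (dtr2_derives i j) (tr2_derives i j).
apply: (mean_half_sum_derives du) => g; rewrite /=.
under eq_bigr do under eq_bigr do rewrite mulrCA.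
under eq_bigr do rewrite big_split/= -mulr_suml -mulr_sumr big_split/=.
rewrite big_split/= -mulr_suml -mulr_sumr big_split/= skew_casimir skew_contract.
by rewrite skew_contract2 SO_orthogonal SO_orthogonal2 mxtrace1 /tr1 /tr2 /tr4; ring.
Qed.

(** The two means a and b satisfy N - b - M a = 0 and N - a - M b = 0. Subtracting gives (N - 2) (a
    - b) = 0, and then N a = N. *)
Lemma mean_tr1_sqr_tr2 : N != 0%N -> N != 2%N ->
  mean (fun g => tr1 g ^+ 2) = 1 /\ mean tr2 = 1.
Proof.
move=> N0 N2.
have b1 := bmeas_tr1; have b2 := bmeas_tr2.
have b11 : bmeas (fun g => tr1 g ^+ 2) by exact: bmeasM.
have e1 : (N%:R - mean tr2) - M * mean (fun g => tr1 g ^+ 2) = 0.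
  rewrite -(@stein_identity tr1 (fun=> 1) (fun=> 0)); last first.
    move=> i j; have := tr1_derives i j; congr derives; apply/funext => g.
    by rewrite mul1r mul0r addr0.
  rewrite (_ : (fun g => _ - _) = fun g => N%:R + ((-1) * tr2 g + (- M) * tr1 g ^+ 2)).
    rewrite !meanD ?meanZ ?mean_cst//; try by bmeas_tac.
    by ring.
  by apply/funext => g; ring.
have e2 : (N%:R - mean (fun g => tr1 g ^+ 2)) - M * mean tr2 = 0.
  rewrite -mean_tr2E.
  rewrite (_ : (fun g => _ - _ - _) = fun g => N%:R + ((-1) * tr1 g ^+ 2 + (- M) * tr2 g)).
    rewrite !meanD ?meanZ ?mean_cst//; try by bmeas_tac.
    by ring.
  by apply/funext => g; ring.
move: (mean _) (mean _) e1 e2 => a b e1 e2.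
have N2' : N%:R - 2 != 0 :> R by rewrite subr_eq0 eqr_nat.
have N0' : N%:R != 0 :> R by rewrite pnatr_eq0.
have ab : a = b.
  have : (N%:R - 2) * (a - b) = (N%:R - a - M * b) - (N%:R - b - M * a) by ring.
  by rewrite e1 e2 subrr => /eqP; rewrite mulf_eq0 (negbTE N2') subr_eq0 => /eqP.
subst b; suff : a = 1 by [].
apply: (mulfI N0'); rewrite mulr1; apply/esym/eqP; rewrite -subr_eq0 -e2.
by apply/eqP; ring.
Qed.

(* The exact value is 2 for large N; 8 is what the constant sqrt 2 / n leaves room for. *)
Lemma mean_tr2_dev : (2 < N)%N -> mean (fun g => (tr2 g - 1) ^+ 2) <= 8.
Proof.
move=> N3; have [||m1 m2] := mean_tr1_sqr_tr2; [by case: N N3|by case: N N3 => [|[|[|]]]|].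
have b1 := bmeas_tr1; have b2 := bmeas_tr2; have b4 := bmeas_tr4.
have b11 : bmeas (fun g => tr1 g ^+ 2) by exact: bmeasM.
have b22 : bmeas (fun g => tr2 g ^+ 2) by exact: bmeasM.
have N3' : 3 <= N%:R :> R by rewrite (ler_nat _ 3).
(* As |tr2| and |tr4| are at most N, (N - tr1^2) tr2 <= N tr2 + N tr1^2 and 2 (N - tr4) <= 4 N; the
   means equal to 1 turn this into N + N + 4 N. *)
have le6 : M * mean (fun g => tr2 g ^+ 2) <= 6 * N%:R.
  have : mean (fun g => (N%:R - tr1 g ^+ 2) * tr2 g + 2 * (N%:R - tr4 g) - M * tr2 g ^+ 2)
     <= mean (fun g => N%:R * tr2 g + (N%:R * tr1 g ^+ 2 + (4 * N%:R + (- M) * tr2 g ^+ 2))).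
    apply: mean_le.
    - rewrite (_ : (fun g => _) = fun g => (N%:R + (-1) * tr1 g ^+ 2) * tr2 g +
        (2 * (N%:R + (-1) * tr4 g) + (-M) * tr2 g ^+ 2)).
        by bmeas_tac.
      by apply/funext => g; ring.
    - by bmeas_tac.
    - move=> g; have := tr2_le g; have := tr4_le g; rewrite !ler_norml.
      move=> /andP[h1 h2] /andP[h3 h4].
      have : 0 <= tr1 g ^+ 2 * (N%:R + tr2 g) by rewrite mulr_ge0 ?sqr_ge0//; lra.
      nra.
  rewrite mean_tr2_sqrE !meanD ?meanZ ?mean_cst//; try by bmeas_tac.
  by rewrite m1 m2; lra.
have -> : mean (fun g => (tr2 g - 1) ^+ 2) = mean (fun g => tr2 g ^+ 2) - 1.
  rewrite (_ : (fun g => (tr2 g - 1) ^+ 2) = fun g => tr2 g ^+ 2 + ((-2) * tr2 g + 1)).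
    by rewrite !meanD ?meanZ ?mean_cst//; try (by bmeas_tac); rewrite m2; ring.
  by apply/funext => g; ring.
(* For N >= 3, 6 N / (N - 1) <= 9. *)
nra.
Qed.

End moments.

(** * Stein's method for the trace *)

Section stein_method.
Context {R : realType} {N : nat}.
Variable P : probability (borel_SO R N) R.
Hypothesis haarP : is_haar P.
Implicit Types (i j : 'I_N) (a : R).
Local Notation T := (borel_SO R N).
Local Notation drv i j := (derives (@rotation R N i j) rot_step).
Local Notation mean := (mean P).
Local Notation M := (N%:R - 1 : R).
Local Notation dtr1 i j := (fun g : T => \tr (skew i j *m (g : SO R N))).

(** Reduces the kink of the Stein solution to that of an absolute value, which [derives_absB]
    handles. *)
Lemma min_normE (x a : R) : Num.min x a = 2^-1 * (x + a + (-1) * `|x - a|).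
Proof.
have [xa|ax] := leP x a.
  by rewrite ler0_norm ?subr_le0//; field.
by rewrite gtr0_norm ?subr_gt0//; field.
Qed.

Lemma expR_gaussK (x : R) : expR (x ^+ 2 / 2) * gauss x = 1.
Proof. by rewrite expR_gauss mulVf// gt_eqF// gauss_gt0. Qed.

Lemma stein_sol_derives a i j :
  drv i j (fun g => stein_sol a (tr1 g))
    (fun g => stein_der a (tr1 g) * dtr1 i j g +
       (- 2^-1 * (tr1 g == a)%:R) * `|dtr1 i j g|).
Proof.
have s0 := @rot_step_gt0 R; have sc := cvg_rot_step (R := R).
have dW : drv i j tr1 (dtr1 i j) by exact: tr1_derives.
have dE u u' : drv i j u u' ->
    drv i j (fun g => expR (u g)) (fun g => expR (u g) * u' g).
  apply: (derives_comp s0 sc (fun x => is_derive_expR x) (@continuous_expR R)).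
  move=> B; exists (expR B) => x xB; rewrite gtr0_norm ?expR_gt0// ler_expR.
  exact: le_trans (ler_norm _) xB.
have dpsi u u' : drv i j u u' ->
    drv i j (fun g => gauss_int (u g)) (fun g => gauss (u g) * u' g).
  apply: (derives_comp s0 sc (@is_derive_gauss_int R) (@continuous_gauss R)).
  by move=> B; exists 1 => x _; rewrite gtr0_norm ?gauss_gt0// gauss_le1.
have dm := dpsi _ _ (derivesZ s0 sc 2^-1 (derivesD (derivesD dW (derives_cst _ _ a))
  (derivesZ s0 sc (-1) (derives_absB s0 sc a dW)))).
have dD := derivesD dm (derivesZ s0 sc (- Gauss_cdf a) (dpsi _ _ dW)).
have := derivesM s0 sc (dE _ _ (derivesZ s0 sc 2^-1 (derivesM s0 sc dW dW))) dD.
have sqE (x : R) : 2^-1 * (x * x) = x ^+ 2 / 2 by rewrite mulrC expr2.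
congr derives; apply/funext => g; rewrite sqE -min_normE.
  by rewrite /stein_sol mulNr.
rewrite /stein_der /half_step /stein_sol.
have := expR_gaussK (tr1 g); set W := tr1 g; set W' := \tr _.
move: (expR (W ^+ 2 / 2)) (Gauss_cdf a) => E F.
(* In each case the product [E * gauss W] is isolated so that it can be replaced by 1. At W = a it
   multiplies the - 1/2 that [min_normE] puts before the absolute value. *)
case: (ltgtP W a) => [Wa|Wa|<-]; rewrite /=.
- rewrite ltr0_sg ?subr_lt0// => e1; move: (gauss_int W) => G.
  transitivity (W * (E * (G + - F * G)) * W' + (1 - F) * (E * gauss W) * W'); first by field.
  by rewrite e1; field.
- rewrite gtr0_sg ?subr_gt0// => e1; move: (gauss_int W) (gauss_int a) => G A.
  transitivity (W * (E * (A + - F * G)) * W' - F * (E * gauss W) * W'); first by field.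
  by rewrite e1; field.
- rewrite subrr sgr0 => e1; move: (gauss_int W) => G.
  transitivity (W * (E * (G + - F * G)) * W' + (E * gauss W) * (2^-1 - F) * W'
    - (E * gauss W) * 2^-1 * `|W'|); first by field.
  by rewrite e1; field.
Qed.

Lemma measurable_leq (u : T -> R) a : measurable_fun setT u ->
  measurable [set g | (u g <= a)%R].
Proof.
move=> mu; have := mu measurableT _ (measurable_itv `]-oo, a]).
by rewrite setTI; congr measurable; apply/seteqP; split => g; rewrite /= in_itv.
Qed.

Lemma bmeas_leq_ind (u : T -> R) a : measurable_fun setT u ->
  bmeas (fun g => (u g <= a)%R%:R : R).
Proof.
move=> mu; split; last by exists 1 => g; rewrite ger0_norm ?ler0n// lern1 leq_b1.
rewrite (_ : (fun g => _) = \1_[set g | (u g <= a)%R]).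
  by apply: measurable_indic; apply: measurable_leq.
by apply/funext => g; rewrite indicE; congr ((nat_of_bool _)%:R); apply/idP/idP; rewrite inE.
Qed.

(** The average of the indicators of x <= a and x < a, the latter written through a closed half-line
    so that one measurability lemma serves both. *)
Lemma half_stepE a x : half_step a x =
  2^-1 * ((x <= a)%R%:R + (1 + (-1) * (- x <= - a)%R%:R)).
Proof.
rewrite /half_step lerN2; case: (ltgtP x a) => [xa|xa|->].
- by rewrite ltr0_sg ?subr_lt0//=; field.
- by rewrite gtr0_sg ?subr_gt0//=; field.
- by rewrite subrr sgr0/=; field.
Qed.

Lemma mean_leq_ind (u : T -> R) a : measurable_fun setT u ->
  mean (fun g => (u g <= a)%R%:R) = fine (P [set g | (u g <= a)%R]).
Proof.
move=> mu; rewrite /mean /Rintegral; congr fine.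
rewrite -[in RHS](setIT [set g | (u g <= a)%R]) -integral_indic//.
  apply: eq_integral => g _; rewrite indicE; congr ((nat_of_bool _)%:R%:E).
  by apply/idP/idP; rewrite inE.
exact: measurable_leq.
Qed.

Lemma bmeas_half_step a : bmeas (fun g : T => half_step a (tr1 g)).
Proof.
have [m1 _] := @bmeas_tr1 R N.
have b1 := bmeas_leq_ind a m1.
have b2 : bmeas (fun g : T => (- tr1 g <= - a)%R%:R : R).
  by apply: bmeas_leq_ind; exact: measurableT_comp.
rewrite (_ : (fun g => _) = fun g : T =>
  2^-1 * ((tr1 g <= a)%R%:R + (1 + (-1) * (- tr1 g <= - a)%R%:R))).
  by bmeas_tac.
by apply/funext => g; exact: half_stepE.
Qed.

Lemma half_step_dist a : (2 < N)%N ->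
  `|mean (fun g => half_step a (tr1 g)) - Gauss_cdf a| <= Num.sqrt 8 / M.
Proof.
move=> N3; have M0 : 0 < M.
  by rewrite subr_gt0 ltr1n; apply: leq_trans N3.
have bh := bmeas_half_step a; have b1 := @bmeas_tr1 R N; have b2 := @bmeas_tr2 R N.
have bS : bmeas (fun g : T => stein_sol a (tr1 g)).
  (* Measurability and boundedness are part of [derives], so any pair of indices gives them, even a
     diagonal one. *)
  have N0 : (0 < N)%N by apply: leq_trans N3.
  by have [] := stein_sol_derives a (Ordinal N0) (Ordinal N0).
have bD : bmeas (fun g : T => stein_der a (tr1 g)).
  rewrite /stein_der (_ : (fun g => _) = fun g : T =>
    tr1 g * stein_sol a (tr1 g) + (half_step a (tr1 g) + (- Gauss_cdf a))) //.
  by bmeas_tac.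
have key : mean (fun g => half_step a (tr1 g)) - Gauss_cdf a =
    mean (fun g => M^-1 * ((tr2 g + (-1)) * stein_der a (tr1 g))).
  have := stein_identity haarP (stein_sol_derives a).
  (* Writes N - tr2 as M - (tr2 - 1) and applies the Stein equation to the part with factor M. *)
  rewrite (_ : (fun g => _ - _) = fun g : T =>
    (- 1) * ((tr2 g + (-1)) * stein_der a (tr1 g)) +
    M * (half_step a (tr1 g) + (- Gauss_cdf a))).
    rewrite meanD ?[mean (fun g => M * _)]meanZ ?meanD ?mean_cst ?meanZ//;
      try by bmeas_tac.
    move/eqP; rewrite mulN1r addrC subr_eq0 => /eqP <-.
    by rewrite mulKf// gt_eqF.
  apply/funext => g; rewrite /stein_der; ring.
rewrite key meanZ; last by bmeas_tac.
rewrite normrM gtr0_norm ?invr_gt0// mulrC ler_pM2r ?invr_gt0//.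
have bnd : forall v : T -> R, bmeas v -> (forall g, `|v g| <= `|tr2 g - 1|) ->
    mean v <= Num.sqrt 8.
  move=> v bv vle.
  have s8 : 0 < Num.sqrt 8 :> R by rewrite sqrtr_gt0.
  have s88 : Num.sqrt 8 ^+ 2 = 8 :> R by rewrite sqr_sqrtr.
  have b22 : bmeas (fun g : T => (tr2 g - 1) ^+ 2).
    rewrite (_ : (fun g => _) = fun g : T => (tr2 g + (-1)) * (tr2 g + (-1)))//.
    by bmeas_tac.
  (* Cauchy-Schwarz in the form 2 s |y| <= y^2 + s^2 with s = sqrt 8; the mean is then at most 16 /
     (2 s) = s. *)
  apply: (@le_trans _ _ (mean (fun g => (2 * Num.sqrt 8)^-1 * ((tr2 g - 1) ^+ 2 + 8)))).
    apply: mean_le => //; first by bmeas_tac.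
    move=> g; rewrite (le_trans (ler_norm _))// (le_trans (vle g))//.
    rewrite mulrC ler_pdivlMr ?mulr_gt0//.
    have := sqr_ge0 (`|tr2 g - 1| - Num.sqrt 8).
    by rewrite sqrrB s88 real_normK ?num_real//; lra.
  rewrite meanZ; last by bmeas_tac.
  rewrite meanD//; last exact: bmeas_cst.
  rewrite mean_cst mulrC ler_pdivrMr ?mulr_gt0//.
  rewrite mulrCA -expr2 s88; have := mean_tr2_dev haarP N3; lra.
have vle g : `|(tr2 g + -1) * stein_der a (tr1 g)| <= `|tr2 g - 1|.
  by rewrite normrM ler_piMr// stein_der_bound.
rewrite ler_norml lerNl -[- mean _]mulN1r -meanZ; last by bmeas_tac.
rewrite !bnd//; try by bmeas_tac.
by move=> g; rewrite mulN1r normrN.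
Qed.

End stein_method.

Theorem theorem3p11 (R : realType) (n : nat) (n_ge2 : (2 <= n)%N)
    (P : probability (borel_SO R (2 * n + 1)) R) (haarP : is_haar P) (x0 : R) :
  `| fine (P [set g : SO R (2 * n + 1) | \tr g <= x0])
     - (Num.sqrt (2 * pi))^-1
       * \int[lebesgue_measure]_(x in `]-oo, x0]) expR (- (x ^+ 2 / 2)) |
  <= Num.sqrt 2 / n%:R.
Proof.
have n0 : 0 < n%:R :> R by rewrite ltr0n (leq_trans _ n_ge2).
have N3 : (2 < 2 * n + 1)%N by rewrite addn1 ltnS (leq_trans n_ge2)// leq_pmull.
rewrite -[_^-1 * _]/(Gauss_cdf x0).
(* N - 1 = 2 n and sqrt 8 = 2 sqrt 2. *)
have dE : Num.sqrt 8 / ((2 * n + 1)%:R - 1) = Num.sqrt 2 / n%:R :> R.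
  rewrite natrD addrK natrM (_ : 8 = 2 ^+ 2 * 2); last by ring.
  by rewrite sqrtrM ?sqr_ge0// sqrtr_sqr ger0_norm//; field; rewrite gt_eqF.
have dist a := half_step_dist haarP a N3.
rewrite dE in dist.
have [m1 _] := @bmeas_tr1 R (2 * n + 1).
rewrite -[P _]/(P [set g | (tr1 g <= x0)%R]) -(mean_leq_ind P x0 m1).
have bi := bmeas_leq_ind x0 m1.
rewrite ler_norml; apply/andP; split.
  (* Lower bound: the half step at x0 lies below the indicator of W <= x0. *)
  have := dist x0; rewrite ler_norml => /andP[+ _]; move/le_trans; apply.
  rewrite lerD2r; apply: mean_le => //; first exact: bmeas_half_step.
  move=> g; rewrite /half_step; case: (ltgtP (tr1 g) x0) => [xa|xa|->].
  - by rewrite ltr0_sg ?subr_lt0//=; lra.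
  - by rewrite gtr0_sg ?subr_gt0//=; lra.
  - by rewrite subrr sgr0/=; lra.
(* Upper bound: the indicator of W <= x0 lies below the half step at x0 + e, and the Lipschitz bound
   charges only e for the shift. *)
rewrite lerBlDr; apply/ler_addgt0Pr => e e0.
have := dist (x0 + e); rewrite ler_norml => /andP[_].
have := @Gauss_cdf_lipschitz R x0 (x0 + e); rewrite lerDl (ltW e0) => /(_ isT).
suff : mean P (fun g => (tr1 g <= x0)%R%:R) <= mean P (fun g => half_step (x0 + e) (tr1 g)).
  lra.
apply: mean_le => //; first exact: bmeas_half_step.
move=> g; rewrite /half_step; have [xa|xa] := leP (tr1 g) x0 => /=.
  by rewrite ltr0_sg ?subr_lt0//; lra.
by rewrite /Num.sg; case: ifP => _; [|case: ifP => _]; lra.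
Qed.
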